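(* Let $\{R_k\}_{k=1}^\infty$ be a sequence of $d\times d$ expansive matrices with integer entries and let $\{B_k\}_{k=1}^\infty$ be a sequence of finite subsets of $\mathbb{Z}^d$ with $\#B_k\ge2$ for all $k\ge1$. Suppose that $\{(R_k,B_k)\}_{k=1}^\infty$ satisfies the remainder bounded condition (RBC) and the uniform contractive condition $\sup_k\|R_k^{-1}\|<1$. Then the infinite convolution $\mu$ of $\{(R_k,B_k)\}_{k=1}^\infty$ exists.
   Context: A matrix is expansive if all its eigenvalues have modulus strictly greater than $1$. $\|\cdot\|$ is the spectral norm, $\#$ denotes cardinality. For a finite nonempty set $A\subseteq\mathbb{R}^d$, $\delta_A=\frac{1}{\#A}\sum_{a\in A}\delta_a$, where $\delta_a$ is the Dirac measure at $a$; $*$ denotes convolution. The infinite convolution of $\{(R_k,B_k)\}_{k=1}^\infty$ exists if the measures $\mu_k=\delta_{R_1^{-1}B_1}*\delta_{(R_2R_1)^{-1}B_2}*\cdots*\delta_{(R_kR_{k-1}\cdots R_1)^{-1}B_k}$ converge weakly, as $k\to\infty$, to a Borel probability measure $\mu$; $\mu$ is then called the infinite convolution of $\{(R_k,B_k)\}_{k=1}^\infty$. Remainder bounded condition (RBC): $\sum_{k=1}^{\infty}\frac{\#B_{k,2}}{\#B_k}<\infty$, where $B_{k,1}=B_k\cap R_k[-\frac12,\frac12)^d$ and $B_{k,2}=B_k\setminus B_{k,1}$. *)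

(* Defs.v *)
From HB Require Import structures.
From mathcomp Require Import all_boot all_order all_algebra finmap.
From mathcomp Require Import complex.
From mathcomp Require Import all_classical all_reals all_analysis giry.

Set Implicit Arguments.
Unset Strict Implicit.
Unset Printing Implicit Defensive.

Import Order.TTheory GRing.Theory Num.Theory.
Import numFieldNormedType.Exports.

Local Open Scope classical_set_scope.
Local Open Scope ring_scope.

(* Column vectors of size d over R, with the Borel sigma-algebra of the
   standard topology. *)
Notation borelV R d := (g_sigma_algebraType (@open 'cV[R]_d)).

Section measurable_addition.
Context (R : realType) (d : nat).
Let V : measurableType _ := borelV R d.

Lemma open_prod_measurable (W : set ('cV[R]_d * 'cV[R]_d)) :
  open W -> measurable (W : set (V * V)).
Proof.
move=> oW.
pose q (p : 'cV[rat]_d) : 'cV[R]_d := map_mx ratr p.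
pose box (t : 'cV[rat]_d * 'cV[rat]_d * nat) : set (V * V) :=
  (ball (q t.1.1) t.2.+1%:R^-1)° `*` (ball (q t.1.2) t.2.+1%:R^-1)°.
pose D := [set t | box t `<=` W].
suff -> : W = \bigcup_(t in D) box t.
  rewrite bigcup_mkcond; apply: countable_bigcupT_measurable => // t.
  case: ifP => // _.
  by apply: measurableX; apply: sub_sigma_algebra; exact: open_interior.
apply/seteqP; split; last by move=> z [t /= tW /tW].
move=> [x y] Wxy.
have /nbhs_ballP[e /= e0 eW] := open_nbhs_nbhs (conj oW Wxy).
have [n ne] : exists n : nat, n.+1%:R^-1 < e / 2.
  have e20 : 0 < e / 2 by rewrite divr_gt0.
  by have [n _ /(_ _ (leqnn n))] := near_infty_natSinv_lt (PosNum e20); exists n.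
have n0 : 0 < n.+1%:R^-1 :> R by rewrite invr_gt0.
have approx (z : 'cV[R]_d) : exists p, (ball (q p) n.+1%:R^-1)° z.
  have A i : exists r : rat, `|z i 0 - ratr r| < n.+1%:R^-1 / 2.
    have : z i 0 - n.+1%:R^-1 / 2 < z i 0 + n.+1%:R^-1 / 2.
      by rewrite ltrBlDr -addrA -splitr ltrDl.
    move=> /rat_in_itvoo[r]; rewrite in_itv/= => /andP[r1 r2].
    by exists r; rewrite distrC ltr_distl r1 r2.
  have [f fz] := choice A.
  exists (\col_i f i); rewrite /interior; apply/nbhs_ballP.
  exists (n.+1%:R^-1 / 2); first by rewrite /= divr_gt0.
  move=> w [_ zw]; split => // i j; rewrite (ord1 j) !mxE.
  apply: (@ball_splitr _ _ (z i 0)); last exact: zw.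
  by rewrite /ball/=; exact: fz.
have [p px] := approx x; have [p' py] := approx y.
exists (p, p', n) => //= -[a b] [/= /interior_subset pa /interior_subset pb].
apply: eW; split => /=; rewrite (splitr e).
- apply: (@ball_triangle _ _ (q p)); apply: (le_ball (ltW ne)) => //.
  by apply: ball_sym; exact: interior_subset px.
- apply: (@ball_triangle _ _ (q p')); apply: (le_ball (ltW ne)) => //.
  by apply: ball_sym; exact: interior_subset py.
Qed.

Lemma measurable_addV :
  measurable_fun [set: V * V] (fun z : V * V => (z.1 + z.2 : 'cV[R]_d) : V).
Proof.
apply: (@measurability _ _ _ V _ _ (@open 'cV[R]_d) erefl) => _ [U oU <-].
rewrite setTI; apply: open_prod_measurable.
by apply: open_comp => // z _; exact: add_continuous.
Qed.

End measurable_addition.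

Section convolution.
Context (R : realType) (d : nat).
Let V : measurableType _ := borelV R d.

(* giry_map is the pushforward, here of the product measure under addition. *)
Definition convolution (mu nu : subprobability V R) : subprobability V R :=
  giry_map (@measurable_addV R d) (product_subprobability (mu, nu)).

End convolution.

(* The uniform probability measure on A; the zero measure if A is empty. *)
Section uniform_measure.
Context (R : realType) (d : nat).
Let V : measurableType _ := borelV R d.
Variable A : {fset 'cV[R]_d}.

Definition uniform_fset (S : set V) : \bar R :=
  ((#|` A|%:R^-1)%:E * \sum_(a <- A) \d_(a : V) S)%E.

Let uniform_fsetE : uniform_fset = mscale (#|` A|%:R^-1)%:nng
  (msum (fun i => [the measure V R of \d_(nth 0 A i : V)]) #|` A|).
Proof.
apply/funext => S; rewrite /uniform_fset /mscale /msum /=.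
by rewrite (big_nth 0) big_mkord.
Qed.

Let uniform_fset0 : uniform_fset set0 = 0%E.
Proof. by rewrite uniform_fsetE measure0. Qed.

Let uniform_fset_ge0 S : (0 <= uniform_fset S)%E.
Proof. by rewrite uniform_fsetE. Qed.

Let uniform_fset_sigma_additive : semi_sigma_additive uniform_fset.
Proof. by rewrite uniform_fsetE; exact: measure_semi_sigma_additive. Qed.

HB.instance Definition _ := isMeasure.Build _ _ _ uniform_fset
  uniform_fset0 uniform_fset_ge0 uniform_fset_sigma_additive.

Let uniform_fset_setT : (uniform_fset setT <= 1)%E.
Proof.
rewrite /uniform_fset (eq_bigr (fun=> 1%:E)); last by move=> a _; rewrite diracT.
rewrite sumEFin big_const_seq count_predT iter_addr_0 -EFinM lee_fin.
have [->|A0] := eqVneq #|` A| 0%N; first by rewrite invr0 mul0r.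
by rewrite mulVf// pnatr_eq0.
Qed.

HB.instance Definition _ :=
  Measure_isSubProbability.Build _ _ _ uniform_fset uniform_fset_setT.

End uniform_measure.

Definition weak_cvg (R : realType) (d : nat)
    (mu_ : nat -> subprobability (borelV R d) R)
    (mu : probability (borelV R d) R) : Prop :=
  forall f : 'cV[R]_d -> R, continuous f -> bounded_fun f ->
    (\int[mu_ n]_x (f x)%:E)%E @[n --> \oo] --> (\int[mu]_x (f x)%:E)%E.

Definition mx_of_int (R : realType) (m n : nat) (A : 'M[int]_(m, n)) :
  'M[R]_(m, n) := map_mx intr A.

Definition expansive (R : realType) (d : nat) (A : 'M[R]_d) : Prop :=
  forall z : R[i], eigenvalue (map_mx (real_complex R) A) z -> 1 < `|z|.

Definition euclidean_norm (R : realType) (d : nat) (x : 'cV[R]_d) : R :=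
  Num.sqrt (\sum_i x i 0 ^+ 2).

Definition spectral_norm (R : realType) (d : nat) (A : 'M[R]_d) : R :=
  sup [set euclidean_norm (A *m x) | x in [set x | euclidean_norm x <= 1]].

(* Sequences indexed by k >= 1 are shifted to start at 0. *)
Section infinite_convolution.
Context (R : realType) (d : nat).
Variables (M : nat -> 'M[int]_d) (B : nat -> {fset 'cV[int]_d}).

Fixpoint rprod (k : nat) : 'M[int]_d :=
  if k is k'.+1 then M k *m rprod k' else M 0.

Definition conv_factor (k : nat) : subprobability (borelV R d) R :=
  uniform_fset
    [fset invmx (mx_of_int R (rprod k)) *m mx_of_int R b | b in B k]%fset.

Fixpoint finite_convolution (k : nat) : subprobability (borelV R d) R :=
  if k is k'.+1 then convolution (finite_convolution k') (conv_factor k)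
  else conv_factor 0.

Definition is_infinite_convolution (mu : probability (borelV R d) R) : Prop :=
  weak_cvg finite_convolution mu.

Definition half_open_cube : set 'cV[R]_d :=
  [set x : 'cV[R]_d | forall i, x i 0 \in `[- 2^-1, 2^-1[ ].

Definition digits_in (k : nat) : {fset 'cV[int]_d} :=
  [fset b in B k |
    `[< ([set mx_of_int R (M k) *m x | x in half_open_cube]) (mx_of_int R b) >]]%fset.

Definition digits_out (k : nat) : {fset 'cV[int]_d} :=
  (B k `\` digits_in k)%fset.

Definition remainder_bounded : Prop :=
  (\sum_(0 <= k <oo) (#|` digits_out k|%:R / #|` B k|%:R : R)%:E < +oo)%E.

End infinite_convolution.

(* Main.v *)
(* The maps x |-> floor (x Q_k) mod N_k on [0, 1], where N_k = #B_k and
   Q_k = N_0 ... N_k, are the mixed-radix digits of x: under the uniform law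
   they are independent and uniform on {0, ..., N_k - 1}. Using the k-th digit
   to select an element b_k of B_k realizes all the finite convolutions at once,
   as the laws of the partial sums of the random series
   sum_k (R_k ... R_0)^-1 b_k on one probability space.
   (RBC) is the hypothesis of the Borel-Cantelli lemma for the events
   "b_k is in B_{k,2}": almost surely b_k is in R_k [-1/2, 1/2)^d for k large,
   and then the k-th term is (R_{k-1} ... R_0)^-1 y with y in the cube, of norm
   at most (sup ||R_k^-1||)^k sqrt d / 2. So the series converges almost surely,
   and by dominated convergence the laws of its partial sums converge weakly to
   the law of its sum. *)
Require Import Defs.
From mathcomp Require Import all_boot all_order all_algebra finmap.
From mathcomp Require Import complex.
From mathcomp Require Import all_classical all_reals all_analysis.
From mathcomp Require Import measurable_realfun.

Set Implicit Arguments.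
Unset Strict Implicit.
Unset Printing Implicit Defensive.

Import numFieldNormedType.Exports.

Local Open Scope classical_set_scope.
Local Open Scope ring_scope.

Import Order.TTheory GRing.Theory Num.Theory.

(** * Euclidean and spectral norms; invertibility of expansive matrices *)

Section euclidean.
Context (R : realType) (d : nat).
Implicit Types (x : 'cV[R]_d) (A : 'M[R]_d).

Lemma euclidean_norm_ge0 x : 0 <= euclidean_norm x.
Proof. exact: sqrtr_ge0. Qed.

Lemma euclidean_normZ (t : R) x :
  euclidean_norm (t *: x) = `|t| * euclidean_norm x.
Proof.
rewrite /euclidean_norm -sqrtr_sqr -sqrtrM ?sqr_ge0// mulr_sumr.
by congr Num.sqrt; apply: eq_bigr => i _; rewrite mxE exprMn.
Qed.

Lemma normr_coord_le_euclidean_norm x i : `|x i 0| <= euclidean_norm x.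
Proof.
rewrite -sqrtr_sqr ler_wsqrtr// (bigD1 i)//= lerDl.
by apply: sumr_ge0 => j _; exact: sqr_ge0.
Qed.

Lemma euclidean_norm_coord_le (x y : 'cV[R]_d) :
  (forall i, `|x i 0| <= `|y i 0|) -> euclidean_norm x <= euclidean_norm y.
Proof.
move=> xy; apply: ler_wsqrtr; apply: ler_sum => i _.
rewrite -[x i 0 ^+ 2]real_normK ?num_real//.
by rewrite -[y i 0 ^+ 2]real_normK ?num_real// lerXn2r// nnegrE.
Qed.

(** By homogeneity this reduces to the unit ball. As [sup] bounds only the elements of a set bounded
    above, an explicit bound is supplied: the norm of the vector of absolute row sums of [A]. *)
Lemma euclidean_norm_mulmx_le_spectral_norm A x :
  euclidean_norm (A *m x) <= spectral_norm A * euclidean_norm x.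
Proof.
have unit_bound y : euclidean_norm y <= 1 ->
    euclidean_norm (A *m y) <= euclidean_norm (\col_i \sum_j `|A i j|).
  move=> y1; apply: euclidean_norm_coord_le => i.
  rewrite !mxE (le_trans (ler_norm_sum _ _ _))//.
  rewrite [leRHS]ger0_norm ?sumr_ge0//.
  apply: ler_sum => j _; rewrite normrM ler_piMr//.
  exact: le_trans (normr_coord_le_euclidean_norm _ _) y1.
have [x0|x0] := eqVneq (euclidean_norm x) 0.
  have -> : x = 0.
    apply/colP => i; rewrite mxE; apply/eqP; rewrite -normr_le0 -x0.
    exact: normr_coord_le_euclidean_norm.
  have e0 : euclidean_norm (0 : 'cV[R]_d) = 0.
    by rewrite -(scale0r (0 : 'cV[R]_d)) euclidean_normZ normr0 mul0r.
  by rewrite mulmx0 e0 mulr0.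
have x_gt0 : 0 < euclidean_norm x.
  by rewrite lt_neqAle eq_sym x0 euclidean_norm_ge0.
have xV_ge0 : 0 <= (euclidean_norm x)^-1 by rewrite invr_ge0 euclidean_norm_ge0.
rewrite -ler_pdivrMr// mulrC -[X in X * _]ger0_norm//.
rewrite -euclidean_normZ scalemxAr /spectral_norm; apply: ub_le_sup.
  exists (euclidean_norm (\col_i \sum_j `|A i j|)) => _ [y y1 <-].
  exact: unit_bound.
exists ((euclidean_norm x)^-1 *: x) => //=.
by rewrite euclidean_normZ ger0_norm// mulVf.
Qed.

(** A singular matrix has eigenvalue 0, the rank being unchanged by the embedding into the complex
    numbers. *)
Lemma expansive_unitmx A : expansive A -> A \in unitmx.
Proof.
move=> Aexp; apply: contrapT => Anu.
have : eigenvalue (map_mx (real_complex R) A) 0.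
  rewrite /eigenvalue /eigenspace raddf0 subr0 -mxrank_eq0 mxrank_ker.
  rewrite subn_eq0 -ltnNge mxrank_map.
  rewrite ltn_neqAle rank_leq_row andbT; apply/negP => /eqP e.
  by apply/Anu; rewrite -row_free_unit; apply/eqP.
by move=> /Aexp; rewrite normr0 ltr10.
Qed.

End euclidean.

(** * Convergence and Borel measurability of vector-valued maps *)

Lemma is_cvg_coord (R : realType) d (u_ : nat -> 'cV[R]_d) :
  (forall i, cvgn (fun n => u_ n i 0)) -> cvgn u_.
Proof.
move=> cu; apply/cvg_ex; exists (\col_i limn (fun n => u_ n i 0)).
apply/cvg_ballP => e e0.
suff : \forall n \near \oo, forall i,
    ball (limn (fun n => u_ n i 0)) e (u_ n i 0).
  by apply: filterS => n un; split => // i j; rewrite (ord1 j) mxE.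
apply: filter_forall => i.
by have /cvg_ballP := cu i; exact.
Qed.

Section limits.
Context (R : realType) (d : nat).
Let V : measurableType _ := borelV R d.

(** The limit lies in the open set [U] exactly when, for some margin 1/(m+1), all but finitely many
    terms stay that far from the complement; so the preimage of [U] is a countable combination of
    measurable sets. *)
Lemma measurable_fun_cvg_borelV d' (T : measurableType d')
    (g_ : nat -> T -> 'cV[R]_d) (g : T -> 'cV[R]_d) :
  (forall n, measurable_fun [set: T] (g_ n : T -> V)) ->
  (forall x, g_ n x @[n --> \oo] --> g x) ->
  measurable_fun [set: T] (g : T -> V).
Proof.
move=> mg gg.
apply: (@measurability _ _ _ V _ _ (@open 'cV[R]_d) erefl) => _ [U oU <-].
rewrite setTI.
(* W m is the closed set of the points whose 1/(m+1)-ball lies in U. *)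
pose W (m : nat) : set V := ~` \bigcup_(w in ~` U) ball w (m.+1%:R^-1 : R).
have -> : g @^-1` U =
    \bigcup_m \bigcup_N \bigcap_(n in [set n | (N <= n)%N]) (g_ n @^-1` W m).
  apply/seteqP; split => x /=.
  - move=> Ux.
    have /nbhs_ballP[e /= e0 eU] := open_nbhs_nbhs (conj oU Ux).
    have [m me] : exists m : nat, m.+1%:R^-1 < e / 2.
      have e20 : 0 < e / 2 by rewrite divr_gt0.
      have [n _ /(_ _ (leqnn n))] := near_infty_natSinv_lt (PosNum e20).
      by exists n.
    have m0 : 0 < m.+1%:R^-1 :> R by rewrite invr_gt0.
    have /cvg_ballP/(_ _ m0)[N _ NW] := gg x.
    exists m => //; exists N => // n /= Nn [w /= nUw] wg; apply: nUw; apply: eU.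
    rewrite (splitr e); apply: (@ball_triangle _ _ (g_ n x)).
      exact: le_ball (ltW me) _ (NW _ Nn).
    by apply: le_ball (ltW me) _ _; exact: ball_sym.
  - move=> [m _ [N _ NW]]; apply: contrapT => nUx.
    have m0 : 0 < m.+1%:R^-1 :> R by rewrite invr_gt0.
    have /cvg_ballP/(_ _ m0)[N' _ N'W] := gg x.
    apply: (NW (maxn N N') (leq_maxl _ _)); exists (g x) => //.
    exact: N'W (leq_maxr _ _).
apply: bigcupT_measurable => m; apply: bigcupT_measurable => N.
apply: bigcap_measurable; first by exists N => /=.
move=> n _; rewrite -[X in measurable X]setTI; apply: mg => //.
apply: measurableC; apply: sub_sigma_algebra.
by apply: bigcup_open => w _; exact: ball_open.
Qed.

Lemma continuous_measurable_fun_borelV (f : 'cV[R]_d -> R) : continuous f ->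
  measurable_fun [set: V] (f : V -> R).
Proof.
move=> cf; apply: (measurability _ (RGenOpens.measurableE R)).
move=> _ [_ [a [b ->]] <-].
rewrite setTI; apply: sub_sigma_algebra.
by apply: open_comp => // x _; exact: cf.
Qed.

End limits.

(** * Uniform measures on finite lists of points *)

Section uniform_seq.
Context d (T : measurableType d) (R : realType).

(** Points are listed with multiplicity: sums of digits may coincide, and a list keeps the weights
    right where a finite set would merge them. *)
Definition uniform_seq (n : nat) (s : nat -> T) : {measure set T -> \bar R} :=
  mscale (n%:R^-1)%:nng (msum (fun i => \d_(s i)) n).

Lemma uniform_seqE n s S :
  uniform_seq n s S = ((n%:R^-1)%:E * \sum_(i < n) \d_(s i) S)%E.
Proof. by []. Qed.

Lemma integral_uniform_seq n s (f : T -> \bar R) : measurable_fun [set: T] f ->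
  (forall x, 0 <= f x)%E ->
  (\int[uniform_seq n s]_x f x = (n%:R^-1)%:E * \sum_(i < n) f (s i))%E.
Proof.
move=> mf f0; rewrite ge0_integral_mscale//= ge0_integral_measure_sum//.
congr (_ * _)%E; apply: eq_bigr => i _.
by rewrite integral_dirac// diracT mul1e.
Qed.

(** Euclidean division by [m] matches the indices below [n * m] with the pairs of indices. *)
Lemma sum_divn_modn (n m : nat) (F : nat -> nat -> \bar R) :
  (\sum_(i < n * m) F (i %/ m)%N (i %% m)%N =
   \sum_(i < n) \sum_(j < m) F i j)%E.
Proof.
rewrite -(big_mkord xpredT (fun i => F (i %/ m)%N (i %% m)%N)).
rewrite big_nat_mul big_mkord.
apply: eq_bigr => i _.
rewrite -{1}[(i * m)%N]add0n big_addn mulSn addnK big_mkord.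
apply: eq_bigr => j _; rewrite addnC.
have m0 : (0 < m)%N by case: (m) j => [[]|].
by rewrite divnMDl// divn_small// addn0 modnMDl modn_small.
Qed.

(** The list runs [n] times through the first [m] terms of [t], so the factor [n] cancels. *)
Lemma uniform_seq_modn n m (t : nat -> T) S : (0 < n)%N ->
  uniform_seq (n * m) (fun i => t (i %% m)%N) S = uniform_seq m t S.
Proof.
move=> n0; rewrite !uniform_seqE.
rewrite (sum_divn_modn _ _ (fun=> fun j => \d_(t j) S)).
set x := (\sum_(j < m) _)%E.
rewrite (eq_bigr (fun=> 1%:E * x)%E); last by move=> i _; rewrite mul1e.
rewrite -ge0_sume_distrl//.
rewrite sumEFin sumr_const card_ord natrM invfM mulrC EFinM -muleA.
by rewrite [X in (_ * X)%E]muleA -EFinM mulVf ?mul1e// pnatr_eq0 -lt0n.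
Qed.

End uniform_seq.

(** * Convolution of uniform measures on lists *)

Section conv.
Context (R : realType) (d : nat).
Let V : measurableType _ := borelV R d.

(** The index [i] encodes a pair through quotient and remainder by [m], in the same way as
    [digit_sum] splits off its last digit. *)
Lemma convolution_uniform_seq (mu nu : subprobability V R) n m
    (s t : nat -> V) :
  (forall S, measurable S -> mu S = uniform_seq R n s S) ->
  (forall S, measurable S -> nu S = uniform_seq R m t S) ->
  forall S, measurable S -> convolution mu nu S =
    uniform_seq R (n * m)
      (fun i => (s (i %/ m)%N : 'cV[R]_d) + t (i %% m)%N : V) S.
Proof.
move=> mus nut S mS.
pose W : set (V * V) := (fun z => (z.1 + z.2 : 'cV[R]_d) : V) @^-1` S.
have mW : measurable W by rewrite -[W]setTI; exact: measurable_addV.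
(* The product measure of [W] is by definition the integral of the [nu]-measures of its sections. *)
transitivity (\int[mu]_x (nu \o xsection W) x)%E; first by [].
rewrite (eq_measure_integral (uniform_seq R n s)); last first.
  by move=> A mA _; exact: mus.
rewrite integral_uniform_seq//; last exact: measurable_fun_xsection.
rewrite uniform_seqE.
rewrite (sum_divn_modn _ _ (fun i j => \d_((s i : 'cV[R]_d) + t j : V) S)).
rewrite natrM invfM EFinM -muleA; congr (_ * _)%E.
rewrite ge0_sume_distrr; last by move=> i _; apply: sume_ge0.
apply: eq_bigr => i _ /=.
rewrite nut ?uniform_seqE; last exact: measurable_xsection.
congr (_ * _)%E; apply: eq_bigr => j _; rewrite !diracE mem_xsection.
by congr (_%:R%:E); rewrite !inE.
Qed.

(** Injectivity keeps the image from merging points, so both measures carry the same weights. *)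
Lemma uniform_fset_imfset (I : choiceType) (B : {fset I}) (i0 : I)
    (f : I -> V) (S : set V) :
  injective f ->
  uniform_fset [fset f b | b in B]%fset S =
  uniform_seq R #|` B| (fun i => f (nth i0 B i)) S.
Proof.
move=> fi; rewrite uniform_seqE /uniform_fset card_imfset//.
congr (_ * _)%E; rewrite big_imfset/=; last by move=> ? ? _ _; exact: fi.
by rewrite (big_nth i0) big_mkord.
Qed.

End conv.

(** * Equal subdivisions of the unit interval *)

Section cell.
Context (R : realType).

(* Num.truncn is 0 on negative numbers, so cell Q x = 0 for all x < 0. *)
Definition cell (Q : nat) (x : R) : nat := Num.truncn (x * Q%:R).

(** Each interval of length 1/Q is cut into [N] equal pieces, so the quotient of the fine index by
    [N] is the coarse index. For negative [x] both are 0. *)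
Lemma cell_divn Q N x : (0 < N)%N -> cell Q x = (cell (Q * N) x %/ N)%N.
Proof.
move=> N0; rewrite /cell; have [x0|x0] := ltP (x * Q%:R) 0.
  have e (y : R) : y < 0 -> Num.truncn y = 0%N.
    by move=> y0; apply/eqP; rewrite -leqn0 truncn_le_nat (lt_trans y0).
  by rewrite !e ?div0n// natrM mulrA nmulr_rlt0// ltr0n.
have xN0 : 0 <= x * (Q * N)%:R by rewrite natrM mulrA mulr_ge0.
apply: truncn_def; rewrite -(ler_pM2r (_ : 0 < N%:R)) ?ltr0n//.
rewrite -[X in _ && X](ltr_pM2r (_ : 0 < N%:R)) ?ltr0n// -!natrM -mulrA -natrM.
rewrite -truncn_ge_nat// -truncn_lt_nat// leq_divM/=.
by rewrite -ltn_divLR.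
Qed.

(** Index 0 is left out because its cell also contains the negative numbers. *)
Lemma cell_eqS Q x i : (cell Q x == i.+1) = (i.+1%:R <= x * Q%:R < i.+2%:R).
Proof.
rewrite /cell; apply/eqP/idP => [e|]; last exact: truncn_def.
have : (0 < Num.truncn (x * Q%:R))%N by rewrite e.
by rewrite truncn_gt0 => /(le_trans ler01)/truncn_itv; rewrite e.
Qed.

Lemma measurable_cell Q : measurable_fun [set: R] (cell Q).
Proof.
move=> _ J _; rewrite setTI.
have -> : cell Q @^-1` J = \bigcup_(i in J) (cell Q @^-1` [set i]).
  by apply/seteqP; split => [x Jx|x [i Ji /= ->]//]; exists (cell Q x).
apply: bigcup_measurable => i _.
have mXQ : measurable_fun [set: R] (fun x : R => x * Q%:R).
  exact: measurable_funM.
case: i => [|i].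
  rewrite [X in measurable X](_ : _ =
      (fun x : R => x * Q%:R) @^-1` `]-oo, 1[%classic).
    by rewrite -[X in measurable X]setTI; apply: mXQ.
  apply/seteqP; split => x /=; rewrite in_itv/= /cell;
    by rewrite -(truncn_le_nat _ 0) leqn0 => /eqP.
rewrite [X in measurable X](_ : _ =
      (fun x : R => x * Q%:R) @^-1` `[i.+1%:R, i.+2%:R[%classic).
  by rewrite -[X in measurable X]setTI; apply: mXQ.
by apply/seteqP; split => x /=; rewrite in_itv/= -cell_eqS => /eqP.
Qed.

(** The cells of index below [Q] cut [0, 1[ into intervals of length 1/Q, so the index is uniform on
    {0, ..., Q - 1}. *)
Lemma uniform_prob_cell Q (J : set nat) : (0 < Q)%N ->
  uniform_prob (@ltr01 R) (cell Q @^-1` J) = uniform_seq R Q id J.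
Proof.
move=> Q0; have mA K : measurable (cell Q @^-1` K).
  by rewrite -[X in measurable X]setTI; exact: measurable_cell.
have PE A : measurable A ->
    uniform_prob (@ltr01 R) A = lebesgue_measure (A `&` `[0, 1[).
  move=> mA'; rewrite /uniform_prob integral_uniform_pdf.
  rewrite (eq_integral (fun=> 1%:E)); last first.
    move=> x; rewrite inE => -[_]; rewrite /= in_itv/= /uniform_pdf => ->.
    by rewrite subr0 invr1.
  rewrite integral_cst ?mul1e; last exact: measurableI.
  (* The endpoint 1 has index [Q], out of range, and is removed as a null set. *)
  rewrite -(@setUitv1 _ _ (BLeft 0) 1 true) ?bnd_simp// setIUr.
  rewrite measureU0//; [exact: measurableI|exact: measurableI|].
  apply: subset_measure0 (@lebesgue_measure_set1 R 1) => //.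
  exact: measurableI.
rewrite PE; last exact: mA.
pose F i : set R :=
  if i \in J then `[i%:R / Q%:R, i.+1%:R / Q%:R[%classic else set0.
have FE i x : F i x <-> [/\ J i, 0 <= x & cell Q x = i].
  rewrite /F /cell; case: ifPn => [/set_mem Ji|/negP iJ]; last first.
    by split => // -[Ji]; case: iJ; exact: mem_set.
  rewrite /= in_itv/= ler_pdivrMr ?ltr0n// ltr_pdivlMr ?ltr0n//.
  split => [xi|[_ x0 <-]]; last by rewrite truncn_itv// mulr_ge0.
  split => //; last exact: truncn_def.
  have /andP[+ _] := xi.
  by move=> /(le_trans (ler0n _ _)); rewrite pmulr_lge0// ltr0n.
have -> : cell Q @^-1` J `&` `[0, 1[%classic = \big[setU/set0]_(i < Q) F i.
  rewrite -bigcup_mkord; apply/seteqP; split => x /=.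
    move=> [Jx]; rewrite in_itv/= => /andP[x0 x1].
    exists (cell Q x); last exact/FE.
    by rewrite /= /cell truncn_lt_nat ?mulr_ge0// gtr_pMl// ltr0n.
  move=> [i /= iQ /FE[Ji x0 xi]]; split; first by rewrite xi.
  rewrite in_itv/= x0 -(@ltr_pM2r _ Q%:R) ?ltr0n// mul1r.
  by rewrite -truncn_lt_nat ?mulr_ge0// [Num.truncn _]xi.
rewrite measure_bigsetU//; last first.
- apply/trivIsetP => i j _ _ ij; apply/seteqP; split => x //=.
  by move=> -[/FE[_ _ xi] /FE[_ _ xj]]; move: ij; rewrite -xi -xj eqxx.
- move=> i; rewrite /F; case: ifP => _; last exact: measurable0.
  exact: measurable_itv.
rewrite uniform_seqE ge0_sume_distrr//; apply: eq_bigr => i _.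
rewrite diracE /F; case: ifPn => iJ; last by rewrite measure0 mule0.
rewrite [LHS](lebesgue_measure_itv `[i%:R / Q%:R, i.+1%:R / Q%:R[)/=.
rewrite lte_fin ltr_pM2r ?invr_gt0 ?ltr0n// ltr_nat ltnSn.
by rewrite mule1 -EFinB -mulrBl -natrB// subSnn mul1r.
Qed.

End cell.

(** * Mixed-radix digits and finite convolutions *)

Section mixed_radix.
Context (R : realType) (d : nat) (N : nat -> nat) (a : nat -> nat -> 'cV[R]_d).
Hypothesis N_gt0 : forall k, (0 < N k)%N.
Let V : measurableType _ := borelV R d.

Definition radix (k : nat) : nat := \prod_(i < k.+1) N i.

Lemma radixS k : radix k.+1 = (radix k * N k.+1)%N.
Proof. by rewrite /radix big_ord_recr. Qed.

Lemma radix_gt0 k : (0 < radix k)%N.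
Proof. apply: prodn_gt0 => i; exact: N_gt0. Qed.

Lemma radix_factor k : exists2 n, (0 < n)%N & radix k = (n * N k)%N.
Proof.
case: k => [|k]; first by exists 1%N => //; rewrite /radix big_ord1 mul1n.
by exists (radix k); [exact: radix_gt0|exact: radixS].
Qed.

Definition digit (k : nat) (x : R) : nat := (cell (radix k) x %% N k)%N.

(* The mixed-radix digits of m, the one of index k being the least significant,
   select the summands. *)
Fixpoint digit_sum (k m : nat) : 'cV[R]_d :=
  if k is k'.+1 then digit_sum k' (m %/ N k)%N + a k (m %% N k)%N
  else a 0 (m %% N 0)%N.

(** The cell index at level [k.+1] divided by [N k.+1] is the cell index at level [k], so decoding
    the finest index yields every digit. The last digit has index [k], hence the bound [k.+1]. *)
Lemma digit_sum_cell k x :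
  digit_sum k (cell (radix k) x) = series (fun i => a i (digit i x)) k.+1.
Proof.
rewrite seriesEord/=; elim: k => [|k IH]; first by rewrite big_ord1.
by rewrite /= big_ord_recr/= -IH /digit radixS -cell_divn ?N_gt0.
Qed.

Let P := uniform_prob (@ltr01 R).

Lemma uniform_prob_digit_sum k (S : set V) :
  P ((fun x => digit_sum k (cell (radix k) x)) @^-1` S) =
  uniform_seq R (radix k) (digit_sum k : nat -> V) S.
Proof. exact: (uniform_prob_cell R (digit_sum k @^-1` S) (radix_gt0 k)). Qed.

(** The cell index is uniform below a multiple of [N k], so its remainder modulo [N k] is
    uniform. *)
Lemma uniform_prob_digit k (J : set nat) :
  P (digit k @^-1` J) = uniform_seq R (N k) id J.
Proof.
transitivity (uniform_seq R (radix k) (modn^~ (N k)) J).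
  exact: (uniform_prob_cell R ((modn^~ (N k)) @^-1` J) (radix_gt0 k)).
have [n n0 ->] := radix_factor k.
exact: (uniform_seq_modn R (N k) id J n0).
Qed.

Lemma measurable_comp_cell d' (T : measurableType d') Q (F : nat -> T) :
  measurable_fun [set: R] (F \o cell Q).
Proof.
by move=> _ S _; exact: (@measurable_cell R Q measurableT (F @^-1` S) I).
Qed.

Lemma measurable_digit k : measurable_fun [set: R] (digit k).
Proof. exact: (measurable_comp_cell (radix k) (modn^~ (N k))). Qed.

Lemma measurable_digit_sum k :
  measurable_fun [set: R] (fun x => digit_sum k (cell (radix k) x) : V).
Proof. exact: (measurable_comp_cell (radix k) (digit_sum k : nat -> V)). Qed.

(** Independence of the digits enters here as counting: convolving with a new factor multiplies the
    index range by [N k.+1] and appends one digit. *)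
Lemma finite_convolution_digit_sum (M : nat -> 'M[int]_d)
    (B : nat -> {fset 'cV[int]_d}) :
  (forall k S, conv_factor R M B k S =
    uniform_seq R (N k) (a k : nat -> V) S) ->
  forall k S, measurable S -> finite_convolution R M B k S =
    uniform_seq R (radix k) (digit_sum k : nat -> V) S.
Proof.
move=> facE; elim => [|k IH] S mS.
  rewrite [LHS]facE /radix big_ord1 !uniform_seqE; congr (_ * _)%E.
  (* At level 0 the index is a single digit below [N 0], which the remainder leaves unchanged. *)
  by apply: eq_bigr => i _; rewrite /= modn_small.
rewrite radixS.
apply: (convolution_uniform_seq (s := digit_sum k) (t := a k.+1) IH) => // S' _.
exact: facE.
Qed.

End mixed_radix.

(** * Series dominated by a geometric tail *)

Section geometric.
Context (R : realType) (d : nat).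

(** Setting the first [n] terms to 0 does not affect convergence and makes a geometric bound hold
    everywhere. *)
Lemma is_cvg_series_geometric_tail (u : nat -> R) (c C : R) n :
  0 <= c < 1 -> (forall k, (n <= k)%N -> `|u k| <= C * c ^+ k) ->
  cvgn (series u).
Proof.
move=> /andP[c0 c1] uC.
pose w k := if (k < n)%N then 0 else u k.
rewrite -(is_cvg_series_restrict n) [X in cvgn X](_ : _ =
    (fun m => \sum_(n <= k < m) w k)); last first.
  apply/funext => m /=; apply: eq_big_nat => k /andP[nk _].
  by rewrite /w ltnNge nk.
rewrite is_cvg_series_restrict; apply: normed_cvg.
apply: (@series_le_cvg _ _ (geometric `|C| c)) => //=.
- by move=> k; rewrite mulr_ge0// exprn_ge0.
- move=> k; rewrite /w; case: ltnP => [_|nk].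
    by rewrite normr0 mulr_ge0// exprn_ge0.
  rewrite (le_trans (uC _ nk))// ler_wpM2r ?exprn_ge0//; exact: ler_norm.
- by apply: is_cvg_geometric_series; rewrite ger0_norm.
Qed.

Lemma is_cvg_series_geometric_tail_cV (u : nat -> 'cV[R]_d) (c C : R) n :
  0 <= c < 1 -> (forall k, (n <= k)%N -> euclidean_norm (u k) <= C * c ^+ k) ->
  cvgn (series u).
Proof.
move=> c01 uC; apply: is_cvg_coord => i.
rewrite [X in cvgn X](_ : _ = series (fun k => u k i 0)); last first.
  by apply/funext => m; rewrite /series/= summxE.
apply: (is_cvg_series_geometric_tail c01 (C := C) (n := n)) => k nk.
exact: le_trans (normr_coord_le_euclidean_norm _ _) (uC _ nk).
Qed.

End geometric.

(** * Contraction by inverse matrix products *)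

Section contraction.
Context (R : realType) (d : nat) (M : nat -> 'M[int]_d).
Hypothesis M_unit : forall k, mx_of_int R (M k) \in unitmx.

Lemma mx_of_int_mulmx (A A' : 'M[int]_d) :
  mx_of_int R (A *m A') = mx_of_int R A *m mx_of_int R A'.
Proof. exact: map_mxM. Qed.

Lemma rprod_unitmx k : mx_of_int R (rprod M k) \in unitmx.
Proof.
by elim: k => [|k IH] //=; rewrite mx_of_int_mulmx unitmx_mul M_unit.
Qed.

(** [rprod M k] has [k + 1] factors and [M k] cancels one of them, which leaves [k] contractions by
    [c]. *)
Lemma euclidean_norm_rprodV (c : R) k (y : 'cV[R]_d) : 0 <= c ->
  (forall k, spectral_norm (invmx (mx_of_int R (M k))) <= c) ->
  euclidean_norm (invmx (mx_of_int R (rprod M k)) *m (mx_of_int R (M k) *m y))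
    <= c ^+ k * euclidean_norm y.
Proof.
move=> c0 Mc; elim: k y => [|k IH] y /=; first by rewrite mulKmx// expr0 mul1r.
set x := invmx _ *m _.
(* The factor [M k.+1] cancels; inserting [M k] and its inverse in front of [y] gives the form of
   the induction hypothesis. *)
have -> : x = invmx (mx_of_int R (rprod M k)) *m
    (mx_of_int R (M k) *m (invmx (mx_of_int R (M k)) *m y)).
  rewrite mulKVmx// -[LHS](mulKmx (rprod_unitmx k)); congr (_ *m _).
  rewrite -[LHS](mulKmx (M_unit k.+1)) -[RHS](mulKmx (M_unit k.+1)).
  congr (_ *m _); rewrite mulmxA -mx_of_int_mulmx /x mulKVmx//.
  exact: (rprod_unitmx k.+1).
rewrite (le_trans (IH _))// exprSr -mulrA ler_wpM2l ?exprn_ge0//.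
rewrite (le_trans (euclidean_norm_mulmx_le_spectral_norm _ _))//.
by rewrite ler_wpM2r ?euclidean_norm_ge0.
Qed.

Lemma euclidean_norm_half_open_cube (y : 'cV[R]_d) : half_open_cube y ->
  euclidean_norm y <= euclidean_norm (const_mx 2^-1 : 'cV[R]_d).
Proof.
move=> yc; apply: euclidean_norm_coord_le => i; rewrite mxE.
have := yc i; rewrite in_itv/= => /andP[y1 y2].
by rewrite [leRHS]ger0_norm ?invr_ge0// ler_norml y1 ltW.
Qed.

End contraction.

(** * Counting list entries and integrating bounded functions *)

Lemma sum_mem_nth (T : choiceType) (x0 : T) (A D : {fset T}) :
  (D `<=` A)%fset -> (\sum_(i < #|` A|) (nth x0 A i \in D) = #|` D|)%N.
Proof.
move=> DA.
rewrite -(big_mkord xpredT (fun i => nat_of_bool (nth x0 A i \in D))).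
rewrite -(big_nth x0 xpredT (fun b => nat_of_bool (b \in D))).
rewrite -(big_mkcond (fun b => b \in D) (fun=> 1%N)) sum1_count -size_filter.
apply: perm_size; apply: uniq_perm; rewrite ?filter_uniq ?fset_uniq// => b.
by rewrite mem_filter; case: (boolP (b \in D)) => //= /(fsubsetP DA).
Qed.

(** This is how almost sure convergence gives weak convergence of laws: continuity of [f] carries it
    to the values, which a constant dominates. *)
Lemma dominated_cvg_bounded d (T : measurableType d) (R : realType)
    (P : probability T R) (n : nat) (g_ : nat -> T -> 'cV[R]_n)
    (g : T -> 'cV[R]_n) (f : 'cV[R]_n -> R) :
  (forall k, measurable_fun [set: T] (g_ k : T -> borelV R n)) ->
  measurable_fun [set: T] (g : T -> borelV R n) ->
  (\forall x \ae P, g_ k x @[k --> \oo] --> g x) ->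
  continuous f -> bounded_fun f ->
  (\int[P]_x (f (g_ k x))%:E)%E @[k --> \oo] --> (\int[P]_x (f (g x))%:E)%E.
Proof.
move=> mg_ mg gg cf [C [_ fC]].
have mf := continuous_measurable_fun_borelV cf.
(* [bounded_fun] bounds [f] by every number above [C], so [C + 1] serves as majorant. *)
have [] := @dominated_convergence _ _ _ P setT measurableT
  (fun k x => (f (g_ k x))%:E) (fun x => (f (g x))%:E) (cst (C + 1)%:E) => //.
- by move=> k; apply/measurable_EFinP; exact: (measurableT_comp mf (mg_ k)).
- by apply/measurable_EFinP; exact: (measurableT_comp mf mg).
- apply: filterS gg => x gx _; apply: cvg_EFin; first exact: nearW.
  exact: (continuous_cvg _ (cf (g x)) gx).
- exact: (finite_measure_integrable_cst P (C + 1)).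
- by apply: aeW => x k _ /=; rewrite lee_fin; apply: fC => //; rewrite ltrDl.
Qed.

Lemma integral_pushforward_bounded d (T : measurableType d) (R : realType)
    (P : probability T R) (n : nat) (g : T -> 'cV[R]_n) (f : 'cV[R]_n -> R) :
  measurable_fun [set: T] (g : T -> borelV R n) ->
  continuous f -> bounded_fun f ->
  (\int[pushforward P (g : T -> borelV R n)]_x (f x)%:E =
   \int[P]_x (f (g x))%:E)%E.
Proof.
move=> mg cf [C [_ fC]].
have mf := continuous_measurable_fun_borelV cf.
rewrite (integral_pushforward mg)//; first exact/measurable_EFinP.
apply: (le_integrable _ _ _
  (finite_measure_integrable_cst P (C + 1) measurableT)) => //.
  by apply/measurable_EFinP; exact: (measurableT_comp mf mg).
move=> x _ /=; rewrite lee_fin [leRHS]ger0_norm.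
  by apply: fC => //; rewrite ltrDl.
by rewrite (le_trans (normr_ge0 (f (g x))))// fC// ltrDl.
Qed.

(** * Almost sure convergence of the random expansion *)

Section random_expansion.
Context (R : realType) (d : nat).
Context (M : nat -> 'M[int]_d) (B : nat -> {fset 'cV[int]_d}).
Hypothesis M_unit : forall k, mx_of_int R (M k) \in unitmx.
Hypothesis B_gt0 : forall k, (0 < #|` B k|)%N.
Let V : measurableType _ := borelV R d.
Let W : measurableType _ := measurableTypeR R.
Let P := uniform_prob (@ltr01 R).
Let N k := #|` B k|.

Definition scaled_digit k i : 'cV[R]_d :=
  invmx (mx_of_int R (rprod M k)) *m mx_of_int R (nth 0 (B k) i).

Lemma conv_factorE k S :
  conv_factor R M B k S = uniform_seq R (N k) (scaled_digit k : nat -> V) S.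
Proof.
apply: (uniform_fset_imfset (B k) 0
  (f := fun b => invmx (mx_of_int R (rprod M k)) *m mx_of_int R b)).
move=> b b' /(congr1 (mulmx (mx_of_int R (rprod M k)))).
rewrite !mulKVmx ?rprod_unitmx// => /colP bb'; apply/colP => i.
by have := bb' i; rewrite !mxE => /intr_inj.
Qed.

Definition bad_digit k : set R :=
  digit N k @^-1` [set i | nth 0 (B k) i \in digits_out R M B k].

Lemma measurable_bad_digit k : measurable (bad_digit k).
Proof. by rewrite -[X in measurable X]setTI; exact: measurable_digit. Qed.

(** This turns (RBC) into the summability of probabilities that the Borel-Cantelli lemma asks
    for. *)
Lemma uniform_prob_bad_digit k :
  P (bad_digit k) = (#|` digits_out R M B k|%:R / #|` B k|%:R : R)%:E.
Proof.
rewrite [LHS](uniform_prob_digit R (N := N) B_gt0) uniform_seqE.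
rewrite mulrC EFinM; congr (_ * _)%E.
rewrite -(@sum_mem_nth _ 0 (B k)) ?fsubsetDl// natr_sum -sumEFin.
apply: eq_bigr => i _; rewrite diracE; congr (_%:R%:E); congr nat_of_bool.
by apply/idP/idP => [/set_mem//|/mem_set].
Qed.

Lemma uniform_prob_lim_sup_bad_digit : remainder_bounded R M B ->
  P (lim_sup_set bad_digit) = 0.
Proof.
move=> hB; apply: lim_sup_set_cvg0 => [k|]; first exact: measurable_bad_digit.
by rewrite (eq_eseriesr (fun k _ => uniform_prob_bad_digit k)).
Qed.

Lemma is_cvg_expansion (c : R) (x : R) : 0 <= c < 1 ->
  (forall k, spectral_norm (invmx (mx_of_int R (M k))) <= c) ->
  ~ lim_sup_set bad_digit x ->
  cvgn (series (fun i => scaled_digit i (digit N i x))).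
Proof.
move=> c01 Mc xgood.
(* A point outside the upper limit of the events lies in only finitely many of them. *)
have [n nP] : exists n, forall k, (n <= k)%N -> ~ bad_digit k x.
  apply: contrapT => /forallNP h; apply: xgood => n _.
  have /existsNP[k /not_implyP[nk /contrapT bk]] := h n.
  by exists k.
have [c0 _] := andP c01.
apply: (is_cvg_series_geometric_tail_cV c01 (n := n)
  (C := euclidean_norm (const_mx 2^-1 : 'cV[R]_d))) => k nk.
have : nth 0 (B k) (digit N k x) \in digits_in R M B k.
  have := nP _ nk; rewrite /bad_digit/= /digits_out in_fsetD => /negP.
  have digitB : nth 0 (B k) (digit N k x) \in B k.
    by apply: mem_nth; rewrite ltn_mod; exact: B_gt0.
  by rewrite digitB andbT negbK.
(* The chosen digit is [M k *m y] with [y] in the cube, so the contraction bound applies. *)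
rewrite !inE/= => /andP[_ /asboolP[y ycube yE]].
rewrite /scaled_digit -yE mulrC.
rewrite (le_trans (euclidean_norm_rprodV M_unit k y c0 Mc))//.
by rewrite ler_wpM2l ?exprn_ge0//; exact: euclidean_norm_half_open_cube.
Qed.

Lemma infinite_convolution_exists (c : R) : 0 <= c < 1 ->
  (forall k, spectral_norm (invmx (mx_of_int R (M k))) <= c) ->
  remainder_bounded R M B ->
  exists mu : probability V R, is_infinite_convolution M B mu.
Proof.
move=> c01 Mc hB.
pose S_ k (x : R) : 'cV[R]_d := digit_sum N scaled_digit k (cell (radix N k) x).
have mS_ k : measurable_fun [set: W] (S_ k : W -> V).
  exact: measurable_digit_sum.
pose G := ~` lim_sup_set bad_digit.
have mG : measurable G.
  apply: measurableC; apply: bigcap_measurable => // n _.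
  by apply: bigcup_measurable => k _; exact: measurable_bad_digit.
have mGb : measurable_fun [set: W] (fun x : W => x \in G).
  apply: (measurable_fun_bool true); rewrite setTI.
  rewrite [X in measurable X](_ : _ = G)//.
  by apply/seteqP; split => x /=; [exact: set_mem|exact: mem_set].
(* Setting the sums to 0 on the exceptional set makes convergence hold everywhere, as the
   measurability of the limit requires. *)
pose T_ k (x : R) : 'cV[R]_d := if x \in G then S_ k x else 0.
pose T (x : R) : 'cV[R]_d := if x \in G then limn (S_ ^~ x) else 0.
have mT_ k : measurable_fun [set: W] (T_ k : W -> V).
  by apply: (measurable_fun_ifT mGb) => //; exact: (@measurable_cst _ _ _ V).
have S_cvg x : x \in G -> S_ k x @[k --> \oo] --> limn (S_ ^~ x).
  rewrite inE => Gx; have := is_cvg_expansion c01 Mc Gx.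
  set u := series _ => cu; suff : cvgn (S_ ^~ x) by [].
  (* [S_ k] has [k + 1] terms, hence the shift by one. *)
  rewrite [X in cvgn X](_ : _ = [sequence u (n + 1)%N]_n); last first.
    by apply/funext => k; rewrite /= addn1 /S_ digit_sum_cell.
  have /cvg_ex[l ul] := cu.
  by apply/cvg_ex; exists l; rewrite cvg_shiftn.
have T_cvg x : T_ k x @[k --> \oo] --> T x.
  rewrite /T_ /T; case: ifPn => [|_]; [exact: S_cvg|exact: cvg_cst].
have mT : measurable_fun [set: W] (T : W -> V).
  exact: (measurable_fun_cvg_borelV mT_ T_cvg).
pose Tmix := isMeasurableFun.Build _ _ _ _ _ mT.
pose Tm : {mfun W >-> V} := MeasurableFun.Pack (MeasurableFun.Class Tmix).
exists (distribution P Tm) => f cf bf.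
rewrite [X in _ --> X](integral_pushforward_bounded P mT cf bf).
(* The finite convolution of index [k] is the law of [S_ k], so its integrals move to the sample
   space. *)
rewrite [X in X @ _](_ : _ = fun k => \int[P]_x (f (S_ k x))%:E)%E; last first.
  apply/funext => k; rewrite -(integral_pushforward_bounded P (mS_ k) cf bf).
  apply: eq_measure_integral => [|? S mS _]; first exact: mS_.
  apply: (etrans (finite_convolution_digit_sum conv_factorE k mS)).
  exact/esym/(uniform_prob_digit_sum scaled_digit B_gt0).
apply: dominated_cvg_bounded => //.
(* The unmodified sums [S_] are back, so convergence to [T] is claimed only off this null set. *)
exists (lim_sup_set bad_digit); split.
- by rewrite -[X in measurable X]setCK; exact: measurableC.
- exact: uniform_prob_lim_sup_bad_digit.
- move=> x /=; apply: contra_notP => xG.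
  have xG' : x \in G by exact: mem_set.
  by rewrite /T xG'; exact: S_cvg.
Qed.

End random_expansion.

(** * From the supremum to a contraction constant *)

Unset Implicit Arguments.

Theorem theorem2p5 (R : realType) (d : nat)
    (M : nat -> 'M[int]_d) (B : nat -> {fset 'cV[int]_d})
    (hM : forall k, expansive (mx_of_int R (M k)))
    (hB : forall k, (2 <= #|` B k|)%N)
    (hRBC : remainder_bounded R M B)
    (hUC : (ereal_sup (range (fun k =>
              (spectral_norm (invmx (mx_of_int R (M k))))%:E)) < 1)%E) :
  exists mu : probability (borelV R d) R, is_infinite_convolution M B mu.
Proof.
set s := ereal_sup _ in hUC.
have s_ub k : ((spectral_norm (invmx (mx_of_int R (M k))))%:E <= s)%E.
  by apply: ereal_sup_ubound; exists k.
have s_fin : s \is a fin_num.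
  rewrite fin_numE; apply/andP; split.
    by rewrite -ltNye (lt_le_trans _ (s_ub 0%N))// ltNyr.
  by rewrite -ltey (lt_trans hUC)// ltry.
have snE : s = (fine s)%:E by rewrite fineK.
(* The maximum with 0 gives the required [0 <= c] at once, and stays below 1. *)
apply: (@infinite_convolution_exists R d M B _ _ (Num.max 0 (fine s))) => //.
- by move=> k; exact/expansive_unitmx.
- by move=> k; exact: ltnW.
- by rewrite le_max lexx/= gt_max ltr01 -lte_fin -snE.
- by move=> k; rewrite le_max -[X in _ || X]lee_fin -snE s_ub orbT.
Qed.
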